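(* For all real numbers $L,L'\in[0,2/\pi]$ with $L\le L'$, there exists $w\in\{0,1\}^{\omega}$ such that \[ \liminf_{n\to\infty}\left(\frac{d_n(w)}{n!}\right)^{1/n}=L\quad\text{and}\quad\limsup_{n\to\infty}\left(\frac{d_n(w)}{n!}\right)^{1/n}=L'. \]
   Context: $\{0,1\}^{\omega}$ is the set of infinite binary words $w=w_1w_2\cdots$, $w[k]=w_1\cdots w_k$. For $\pi\in\mathfrak{S}_n$, $\mathrm{Des}(\pi)=x_1\cdots x_{n-1}$ with $x_i=1$ iff $\pi_i>\pi_{i+1}$, and $d_n(w)$ is the number of $\pi\in\mathfrak{S}_n$ with $\mathrm{Des}(\pi)=w[n-1]$. *)

(* Defs.v *)
From mathcomp Require Import all_boot all_order all_algebra all_fingroup.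
From mathcomp Require Import all_classical all_reals all_analysis.

Set Implicit Arguments.
Unset Strict Implicit.
Unset Printing Implicit Defensive.

Import Order.TTheory GRing.Theory Num.Theory.

(* Infinite binary words; letters are indexed from 0, so [w i] is the letter
   w_{i+1}, and [true] is the letter 1. *)
Definition infword := nat -> bool.

(* w[k] = w_1 ... w_k *)
Definition wprefix (w : infword) (k : nat) : seq bool := mkseq w k.

(* One-line notation pi_1 ... pi_n, with values shifted to {0, ..., n-1}. *)
Definition one_line (n : nat) (s : 'S_n) : seq nat :=
  [seq nat_of_ord (s i) | i <- enum 'I_n].

Definition Des (n : nat) (s : 'S_n) : seq bool :=
  mkseq (fun i => nth 0 (one_line s) i.+1 < nth 0 (one_line s) i) n.-1.

Definition d_ (n : nat) (w : infword) : nat :=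
  #|[set s : 'S_n | Des s == wprefix w n.-1]|.

Local Open Scope ring_scope.

(* (d_n(w) / n!)^(1/n); the value at n = 0 is irrelevant to the limits. *)
Definition dratio_root (R : realType) (w : infword) (n : nat) : R :=
  ((d_ n w)%:R / (n`!)%:R) `^ (n%:R^-1).

(* Main.v *)
Require Import Defs.
From mathcomp Require Import all_boot all_order all_algebra all_fingroup.
From mathcomp Require Import all_classical all_reals all_analysis.
From mathcomp Require Import zify ring lra.

Set Implicit Arguments.
Unset Strict Implicit.
Unset Printing Implicit Defensive.

Import Order.TTheory GRing.Theory Num.Theory.
Import numFieldNormedType.Exports.
Local Open Scope ring_scope.

(** Write [p_n = d_n(w) / n!] and [a_n = p_n^(1/n)].  Counting permutations by
    their last value shows [p_n / (n + 1) <= p_(n+1) <= p_n] whatever the next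
    letter is, so [a_(n+1) - a_n -> 0] uniformly in [w].  A prefix can be
    continued so as to pull [a_n] down or up.  Appending [k] ascents gives
    [p_(n+k) <= p_n / k!], so [a] tends to 0.  For the other direction let [f_n]
    be the density of the last of [n] uniform variables on the event that they
    realise the pattern; then [f_(n+1)' = f_n] after an ascent and [- f_n] after
    a descent, and integrating by parts against [sin (pi x / 2)] and
    [cos (pi x / 2)] shows that an alternating continuation multiplies one of
    these two moments by exactly [2 / pi] at each step.  As the moments add up
    to at least [p_n], this gives [p_(n+k) >= (2 / pi)^k p_n / 2], so [a] climbs
    to at least [2 / pi].  By the inequality of arithmetic and geometric means
    [a] stays below [a_n + o(1)] on its way down and above
    [min (a_n, 2 / pi) - o(1)] on its way up, uniformly in [w].  Since the steps
    of [a] tend to 0, it can be stopped within [o(1)] of any target between 0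
    and [2 / pi]; aiming at [L'] and [L] in turn yields the word. *)

(** * Counting by the last value *)

Section last_value.
Local Open Scope nat_scope.
Implicit Types (w : infword) (n k : nat).

(* As everywhere below, n is the length of the prefix w[n], so that the
   permutations have n + 1 letters. *)
Definition dlast w n (j : nat) : nat :=
  #|[set s : 'S_n.+1 | (Des s == wprefix w n) && (s ord_max == j :> nat)]|.

Lemma nth_one_line n (s : 'S_n) (i : 'I_n) : nth 0 (one_line s) i = s i.
Proof.
by rewrite /one_line (nth_map i) ?size_enum_ord ?ltn_ord // nth_ord_enum.
Qed.

Lemma Des_eqP n (s : 'S_n) w :
  reflect (forall i, i.+1 < n ->
             (nth 0 (one_line s) i.+1 < nth 0 (one_line s) i) = w i)
          (Des s == wprefix w n.-1).
Proof.
apply: (iffP eqP) => [eqD i lt_in|eqD].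
  have lt_in1 : i < n.-1 by lia.
  by have := congr1 (nth false ^~ i) eqD; rewrite !nth_mkseq.
by apply/eq_in_map => i; rewrite mem_iota => /= lt_in; apply: eqD; lia.
Qed.

Lemma lift_perm_inj n (i j : 'I_n.+1) : injective (@lift_perm n i j).
Proof.
move=> s t eq_st; apply/permP => k.
by apply: (@lift_inj _ j); rewrite -!(lift_perm_lift i) eq_st.
Qed.

Lemma lift_perm_surj n (i : 'I_n.+1) (t : 'S_n.+1) :
  exists s, t = lift_perm i (t i) s.
Proof.
have t_lift (k : 'I_n.+1.-1) : exists l, t (lift i k) = lift (t i) l.
  have neq_ti : t (lift i k) != t i.
    by rewrite (inj_eq perm_inj) eq_sym neq_lift.
  by case: (unliftP (t i) (t (lift i k))) neq_ti => [l -> _|->];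
    [exists l | rewrite eqxx].
have [f fP] := fin_all_exists t_lift.
have f_inj : injective f.
  move=> k l eq_f; apply: (@lift_inj _ i); apply: (@perm_inj _ t).
  by rewrite !fP eq_f.
exists (perm f_inj); apply/permP => k.
case: (unliftP i k) => [l|] ->; last by rewrite lift_perm_id.
by rewrite lift_perm_lift permE fP.
Qed.

Lemma nth_lift_perm n (j : 'I_n.+2) (s : 'S_n.+1) (i : nat) : i < n.+1 ->
  nth 0 (one_line (lift_perm ord_max j s)) i = bump j (nth 0 (one_line s) i).
Proof.
move=> lt_in; pose k := Ordinal lt_in.
rewrite (nth_one_line s k) -[i](lift_max k) nth_one_line.
by rewrite lift_perm_lift.
Qed.

Lemma nth_last_lift_perm n (j : 'I_n.+2) (s : 'S_n.+1) :
  nth 0 (one_line (lift_perm ord_max j s)) n.+1 = j.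
Proof.
by rewrite (nth_one_line (lift_perm ord_max j s) ord_max) lift_perm_id.
Qed.

Lemma Des_lift_perm n (j : 'I_n.+2) (s : 'S_n.+1) w :
  (Des (lift_perm ord_max j s) == wprefix w n.+1) =
  (Des s == wprefix w n) && ((j <= s ord_max) == w n).
Proof.
have ltn_bump a b : (bump j a < bump j b) = (a < b) by rewrite /bump; lia.
have last_desc : (nth 0 (one_line (lift_perm ord_max j s)) n.+1
    < nth 0 (one_line (lift_perm ord_max j s)) n) = (j <= s ord_max).
  rewrite nth_last_lift_perm nth_lift_perm // (nth_one_line s ord_max).
  by rewrite /bump; lia.
apply/Des_eqP/andP => [desc|[/Des_eqP desc /eqP eq_wn] i].
  split; last by rewrite -last_desc desc.
  apply/Des_eqP => i lt_in; rewrite -desc; last by lia.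
  by rewrite !nth_lift_perm ?ltn_bump //; lia.
rewrite ltnS leq_eqVlt => /predU1P[[->]|lt_in]; first by rewrite last_desc.
by rewrite !nth_lift_perm ?ltn_bump ?desc //; lia.
Qed.

Lemma dlastS w n j : j <= n.+1 ->
  dlast w n.+1 j = \sum_(i < n.+1 | (j <= i) == w n) dlast w n i.
Proof.
rewrite -ltnS => lt_jn; pose J := Ordinal lt_jn.
have -> : dlast w n.+1 j =
    #|[set s : 'S_n.+1 | (Des s == wprefix w n) && ((j <= s ord_max) == w n)]|.
  rewrite -(card_imset _ (@lift_perm_inj _ ord_max J)); apply: eq_card => t.
  rewrite inE; apply/andP/imsetP => [[Dt /eqP tj]|[s]].
    have [s ts] := lift_perm_surj ord_max t.
    exists s; last by rewrite ts; congr lift_perm; apply: val_inj.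
    by move: Dt; rewrite ts Des_lift_perm tj inE.
  by rewrite inE -(Des_lift_perm J) => ? ->; rewrite lift_perm_id.
rewrite -sum1_card (partition_big (fun s : 'S_n.+1 => s ord_max)
  (fun i : 'I_n.+1 => (j <= i) == w n)) => [|s]; last by rewrite inE => /andP[].
apply: eq_bigr => i iw; rewrite sum1_card; apply: eq_card => s.
rewrite unfold_in /= !inE -andbA; case: (_ == wprefix w n) => //=.
by rewrite andbC -val_eqE /=; case: eqP => //= ->.
Qed.

Lemma dlastS_asc w n j : w n = false -> j <= n.+1 ->
  dlast w n.+1 j = \sum_(0 <= i < j) dlast w n i.
Proof.
move=> wn le_jn; rewrite dlastS // wn (big_nat_widen _ _ _ _ _ le_jn) big_mkord.
by apply: eq_bigl => i; rewrite eqbF_neg ltnNge.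
Qed.

Lemma dlastS_desc w n j : w n -> j <= n.+1 ->
  dlast w n.+1 j = \sum_(j <= i < n.+1) dlast w n i.
Proof.
move=> wn le_jn; rewrite dlastS // wn big_geq_mkord.
by apply: eq_bigl => i; rewrite eqb_id.
Qed.

Lemma d_dlast w n : d_ n.+1 w = \sum_(0 <= j < n.+1) dlast w n j.
Proof.
rewrite big_mkord /d_ -sum1_card.
rewrite (partition_big (fun s : 'S_n.+1 => s ord_max) xpredT) //=.
apply: eq_bigr => i _; rewrite sum1_card; apply: eq_card => s.
by rewrite unfold_in /= !inE.
Qed.

Lemma leq_dlast_d w n j : j <= n.+1 -> dlast w n.+1 j <= d_ n.+1 w.
Proof.
move=> le_jn; rewrite dlastS // d_dlast big_mkord.
by rewrite [leqRHS](bigID (fun i : 'I_n.+1 => (j <= i) == w n)) leq_addr.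
Qed.

Lemma leq_d_dS w n : d_ n.+1 w <= d_ n.+2 w.
Proof.
rewrite [leqRHS]d_dlast d_dlast; case wn: (w n).
  by rewrite [leqRHS]big_nat_recl // dlastS_desc ?leq_addr.
by rewrite [leqRHS]big_nat_recr // dlastS_asc ?leq_addl.
Qed.

Lemma leq_dS_d w n : d_ n.+2 w <= n.+2 * d_ n.+1 w.
Proof.
rewrite d_dlast -[leqRHS](@sum_nat_const_nat 0 n.+2).
rewrite big_nat [leqRHS]big_nat; apply: leq_sum => j /andP[_ lt_jn].
exact: leq_dlast_d.
Qed.

Lemma leq_d_fact w n : d_ n w <= n`!.
Proof. by rewrite -card_Sn max_card. Qed.

Lemma d_gt0 w n : 0 < d_ n.+1 w.
Proof.
elim: n => [|n IHn]; last exact: leq_trans (leq_d_dS w n).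
by apply/card_gt0P; exists 1%g; rewrite inE.
Qed.

Lemma sum_bin_col k j : \sum_(0 <= i < j) 'C(i, k) = 'C(j, k.+1).
Proof.
elim: j => [|j IHj]; first by rewrite big_nil bin0n.
by rewrite big_nat_recr //= IHj binS.
Qed.

Lemma leq_dlast_ascents w n k j : (forall i, i <= k -> w (n + i) = false) ->
  j <= (n + k).+1 -> dlast w (n + k).+1 j <= d_ n.+1 w * 'C(j, k).
Proof.
elim: k j => [|k IHk] j asc le_jn.
  by rewrite bin0 muln1 addn0; apply: leq_dlast_d; rewrite -[n]addn0.
rewrite dlastS_asc ?asc // -sum_bin_col big_distrr /=.
rewrite big_nat [leqRHS]big_nat; apply: leq_sum => i /andP[_ lt_ij].
rewrite addnS; apply: IHk => [l le_lk|]; last by lia.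
by apply: asc; lia.
Qed.

Lemma leq_d_ascents w n k : (forall i, i < k -> w (n + i) = false) ->
  d_ (n + k).+1 w <= d_ n.+1 w * 'C((n + k).+1, k).
Proof.
case: k => [|k] asc; first by rewrite addn0 bin0 muln1.
rewrite d_dlast -sum_bin_col big_distrr addnS.
rewrite big_nat [leqRHS]big_nat; apply: leq_sum => i /andP[_ lt_ij].
exact: leq_dlast_ascents.
Qed.

End last_value.

(** * Densities and their trigonometric moments *)

Section bernstein_sums.
Context {R : numFieldType}.
Implicit Types (p : {poly R}) (D : nat -> R) (n : nat).

Definition divpow p n : {poly R} := (n`!%:R)^-1 *: p ^+ n.

Lemma deriv_divpow0 p : (divpow p 0)^`() = 0.
Proof. by rewrite /divpow derivZ expr0 derivC scaler0. Qed.

Lemma deriv_divpowS p n : (divpow p n.+1)^`() = p^`() * divpow p n.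
Proof.
rewrite /divpow derivZ deriv_exp -[_ *+ n.+1]scaler_nat scalerA.
by rewrite factS natrM invfM mulrAC mulVf ?pnatr_eq0 // mul1r scalerAr.
Qed.

Lemma horner_divpow p n x : (divpow p n).[x] = p.[x] ^+ n / n`!%:R.
Proof. by rewrite hornerZ horner_exp mulrC. Qed.

(* n! times this is the polynomial with Bernstein coefficients D 0, ..., D n *)
Definition bernstein_sum D n : {poly R} :=
  \sum_(0 <= j < n.+1) D j *: (divpow 'X j * divpow (1 - 'X) (n - j)).

Lemma deriv_bernstein_sum D n :
  (bernstein_sum D n.+1)^`() = bernstein_sum (fun j => D j.+1 - D j) n.
Proof.
rewrite /bernstein_sum raddf_sum /=.
under eq_bigr do rewrite derivZ derivM scalerDr.
rewrite big_split /= big_nat_recl //= deriv_divpow0 mul0r scaler0 add0r.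
rewrite [X in _ + X]big_nat_recr //= subnn deriv_divpow0 mulr0 scaler0 addr0.
rewrite -big_split /= big_nat [RHS]big_nat; apply: eq_bigr => j /andP[_ lt_jn].
rewrite subSS subSn // !deriv_divpowS derivB derivX derivC sub0r mul1r mulN1r.
by rewrite mulrN scalerN -scalerBl.
Qed.

Lemma horner_bernstein_sum D n x : (bernstein_sum D n).[x] =
  \sum_(0 <= j < n.+1)
    D j * (x ^+ j / j`!%:R * ((1 - x) ^+ (n - j) / (n - j)`!%:R)).
Proof.
rewrite horner_sum; apply: eq_bigr => j _.
by rewrite hornerZ hornerM !horner_divpow !hornerE.
Qed.

Lemma bernstein_sum_at0 D n : (bernstein_sum D n).[0] = D 0%N / n`!%:R.
Proof.
rewrite horner_bernstein_sum big_nat_recl //= big1 ?addr0 => [|j _].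
  by rewrite subn0 subr0 !expr1n fact0 divr1 !mul1r.
by rewrite expr0n /= !mul0r mulr0.
Qed.

Lemma bernstein_sum_at1 D n : (bernstein_sum D n).[1] = D n / n`!%:R.
Proof.
rewrite horner_bernstein_sum big_nat_recr //= big_nat.
rewrite big1 ?add0r => [|j /andP[_ lt_jn]].
  by rewrite subnn expr0 expr1n fact0 divr1 mulr1 mul1r.
by rewrite subrr expr0n subn_eq0 leqNgt lt_jn /= mul0r !mulr0.
Qed.

Lemma bernstein_sum_ge0 D n x :
  (forall j, 0 <= D j) -> 0 <= x <= 1 -> 0 <= (bernstein_sum D n).[x].
Proof.
move=> D_ge0 /andP[x_ge0 x_le1].
rewrite horner_bernstein_sum sumr_ge0 // => j _.
by rewrite !mulr_ge0 ?invr_ge0 ?exprn_ge0 ?subr_ge0.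
Qed.

End bernstein_sums.

Section segment_integral.
Context {R : realType}.
Implicit Types (a b : R) (f F : R -> R).
Local Notation mu := (@lebesgue_measure R).

Lemma is_derive_continuous F f :
  (forall x : R, is_derive x 1 F (f x)) -> continuous F.
Proof.
by move=> dF x; apply/differentiable_continuous/derivable1_diffP; case: (dF x).
Qed.

Lemma continuous_integrable_segment a b f : continuous f ->
  mu.-integrable `[a, b]%classic (EFin \o f).
Proof.
move=> cf; apply: continuous_compact_integrable; first exact: segment_compact.
exact: continuous_subspaceT.
Qed.

Lemma Rintegral_segment_derive a b f F : a < b -> continuous f ->
  (forall x : R, is_derive x 1 F (f x)) ->
  \int[mu]_(x in `[a, b]%classic) f x = F b - F a.
Proof.
move=> lt_ab cf dF; have cF := is_derive_continuous dF.
rewrite /Rintegral (@continuous_FTC2 _ _ F) //.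
- exact: continuous_subspaceT.
- split=> [x _| |]; first by have [] := dF x.
  + by apply: cvg_at_right_filter; exact: cF.
  + by apply: cvg_at_left_filter; exact: cF.
- by move=> x _; rewrite derive1E; have [_ ->] := dF x.
Qed.

End segment_integral.

Section quarter_wave.
Context {R : realType}.
Implicit Types (b : bool) (x : R).

Definition quarter_wave b x : R :=
  if b then sin (pi / 2 * x) else cos (pi / 2 * x).

Lemma is_derive_quarter_wave b x :
  is_derive x 1 (quarter_wave b)
    ((-1) ^+ (~~ b) * (pi / 2) * quarter_wave (~~ b) x).
Proof.
have dscale : is_derive x 1 (fun y : R => pi / 2 * y) (pi / 2).
  apply: trigger_derive (is_deriveZ (pi / 2) (is_derive_id x 1)) _.
  by rewrite /GRing.scale /= mulr1.
case: b.
  apply: trigger_derive (is_derive1_comp (is_derive_sin _) dscale) _.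
  by rewrite expr0 mul1r mulrC.
apply: trigger_derive (is_derive1_comp (is_derive_cos _) dscale) _.
by rewrite expr1 mulN1r !mulNr mulrC.
Qed.

Lemma continuous_quarter_wave b : continuous (quarter_wave b).
Proof. exact: is_derive_continuous (is_derive_quarter_wave b). Qed.

Lemma quarter_wave_itv b x : 0 <= x <= 1 -> 0 <= quarter_wave b x <= 1.
Proof.
move=> /andP[x_ge0 x_le1]; have pi_ge0 := pi_ge0 R.
have arg_ge0 : 0 <= pi / 2 * x by rewrite !mulr_ge0 ?invr_ge0.
have arg_le : pi / 2 * x <= pi / 2 by rewrite ler_piMr ?divr_ge0.
rewrite /quarter_wave; case: b.
  by rewrite sin_le1 sin_ge0_pi // arg_ge0; lra.
by rewrite cos_le1 cos_ge0_pihalf // arg_le; lra.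
Qed.

Lemma quarter_wave_sum_ge1 x : 0 <= x <= 1 ->
  1 <= quarter_wave true x + quarter_wave false x.
Proof.
move=> x01; rewrite -(cos2Dsin2 (pi / 2 * x)) addrC.
have /andP[sin_ge0 sin_le1] := quarter_wave_itv true x01.
have /andP[cos_ge0 cos_le1] := quarter_wave_itv false x01.
by apply: lerD; rewrite expr2 ler_piMr.
Qed.

End quarter_wave.

Section moments.
Context {R : realType}.
Implicit Types (w : infword) (n k : nat) (b : bool).
Local Notation mu := (@lebesgue_measure R).

Definition Des_prob w n : R := (d_ n.+1 w)%:R / n.+1`!%:R.

(* The density of the last of n + 1 independent uniform variables on [0, 1],
   restricted to the event that their descent word is w[n]: if the last one is
   x, each order pattern in which it has rank j has probability
   x^j / j! * (1 - x)^(n - j) / (n - j)!. *)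
Definition density w n : {poly R} :=
  bernstein_sum (fun j => (dlast w n j)%:R) n.

Lemma density_ge0 w n x : 0 <= x <= 1 -> 0 <= (density w n).[x].
Proof. exact: bernstein_sum_ge0. Qed.

Lemma deriv_density w n : (density w n.+1)^`() = (-1) ^+ w n *: density w n.
Proof.
rewrite deriv_bernstein_sum scaler_sumr.
rewrite [LHS]big_nat [RHS]big_nat; apply: eq_bigr => j /andP[_ lt_jn].
rewrite scalerA; congr (_ *: _); case wn: (w n).
  rewrite !dlastS_desc ?(ltnW lt_jn) // (big_ltn lt_jn) natrD.
  by rewrite opprD addrCA subrr addr0 mulN1r.
rewrite !dlastS_asc ?(ltnW lt_jn) // big_nat_recr //= natrD.
by rewrite addrC addKr mul1r.
Qed.

Lemma density_at0 w n : w n = false -> (density w n.+1).[0] = 0.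
Proof.
by move=> wn; rewrite bernstein_sum_at0 dlastS_asc // big_geq ?mul0r.
Qed.

Lemma density_at1 w n : w n -> (density w n.+1).[1] = 0.
Proof.
by move=> wn; rewrite bernstein_sum_at1 dlastS_desc // big_geq ?mul0r.
Qed.

Lemma Rintegral_density w n :
  \int[mu]_(x in `[0, 1]%classic) (density w n).[x] = Des_prob w n.
Proof.
pose F := bernstein_sum (fun j => (\sum_(0 <= i < j) dlast w n i)%:R : R) n.+1.
have F' : F^`() = density w n.
  rewrite deriv_bernstein_sum; apply: eq_bigr => j _; congr (_ *: _).
  by rewrite big_nat_recr //= natrD addrC addKr.
have dF (x : R) : is_derive x 1 (horner F) (density w n).[x].
  by rewrite -F'; exact: is_derive_poly.
rewrite (Rintegral_segment_derive ltr01 _ dF); last exact: continuous_horner.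
by rewrite bernstein_sum_at0 big_geq // mul0r subr0 bernstein_sum_at1 -d_dlast.
Qed.

Definition moment w n b : R :=
  \int[mu]_(x in `[0, 1]%classic) ((density w n).[x] * quarter_wave b x).

Lemma continuous_moment_integrand w n b :
  continuous (fun x => (density w n).[x] * quarter_wave b x).
Proof.
move=> x; apply: cvgM; first exact: continuous_horner.
exact: continuous_quarter_wave.
Qed.

(* Integration by parts; the boundary terms vanish because the density of the
   longer word is 0 at one end of [0, 1] and the wave is 0 at the other. *)
Lemma momentS w n : pi / 2 * moment w n.+1 (~~ w n) = moment w n (w n).
Proof.
pose f x : R := (density w n).[x] * quarter_wave (w n) x.
pose g x : R := pi / 2 * ((density w n.+1).[x] * quarter_wave (~~ w n) x).
pose F x : R := (-1) ^+ w n * ((density w n.+1).[x] * quarter_wave (w n) x).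
have cf : continuous f by exact: continuous_moment_integrand.
have cg : continuous g.
  move=> x; apply: cvgM; first exact: cvg_cst.
  exact: continuous_moment_integrand.
have dF (x : R) : is_derive x 1 F (f x - g x).
  have dprod := is_deriveM (is_derive_poly (density w n.+1) x)
                           (is_derive_quarter_wave (w n) x).
  apply: trigger_derive (is_deriveZ ((-1) ^+ w n) dprod) _.
  rewrite deriv_density hornerZ /f /g /GRing.scale /=.
  by case: (w n); rewrite ?expr0 ?expr1; ring.
have F_boundary : F 1 - F 0 = 0.
  rewrite /F /quarter_wave; case wn: (w n).
    by rewrite density_at1 // mulr0 sin0 mul0r !mulr0 subrr.
  by rewrite density_at0 // mulr1 cos_pihalf mul0r !mulr0 subrr.
have: \int[mu]_(x in `[0, 1]%classic) (f x - g x) = 0.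
  rewrite (Rintegral_segment_derive ltr01 _ dF) // => x.
  by apply: cvgB; [exact: cf|exact: cg].
rewrite RintegralB //; try exact: continuous_integrable_segment.
rewrite RintegralZl //; last first.
  exact/continuous_integrable_segment/continuous_moment_integrand.
by move/eqP; rewrite subr_eq0 eq_sym => /eqP.
Qed.

Lemma moment_le_Des_prob w n b : moment w n b <= Des_prob w n.
Proof.
rewrite -Rintegral_density; apply: le_Rintegral => // [||x x01].
- exact/continuous_integrable_segment/continuous_moment_integrand.
- exact/continuous_integrable_segment/continuous_horner.
have {}x01 : 0 <= x <= 1 by move: x01; rewrite /= in_itv.
by rewrite ler_piMr ?density_ge0 //; have /andP[] := quarter_wave_itv b x01.
Qed.

Lemma Des_prob_le_moments w n :
  Des_prob w n <= moment w n true + moment w n false.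
Proof.
rewrite -Rintegral_density -RintegralD //;
  try exact/continuous_integrable_segment/continuous_moment_integrand.
apply: le_Rintegral => // [||x x01].
- exact/continuous_integrable_segment/continuous_horner.
- apply: continuous_integrable_segment => x.
  by apply: cvgD; exact: continuous_moment_integrand.
have {}x01 : 0 <= x <= 1 by move: x01; rewrite /= in_itv.
by rewrite -mulrDr ler_peMr ?density_ge0 ?quarter_wave_sum_ge1.
Qed.

Lemma alternating_moment w n k b :
  (forall i, (i < k)%N -> w (n + i)%N = b (+) odd i) ->
  moment w (n + k) (b (+) odd k) = (2 / pi) ^+ k * moment w n b.
Proof.
elim: k => [|k IHk] alt; first by rewrite addn0 addbF expr0 mul1r.
rewrite exprS -mulrA -IHk => [|i lt_ik]; last exact/alt/ltnW.
rewrite addnS oddS addbN -(alt k) // -momentS.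
by rewrite mulrA -[2 / pi]invf_div mulVf ?mul1r // gt_eqF ?divr_gt0 ?pi_gt0.
Qed.

End moments.

(** * Variation of the roots *)

Section mean_inequality.
Context {R : realFieldType}.
Implicit Types (x y z c : R) (n k : nat).

Lemma le_mean_of_expr_le x y z n k :
  (0 < n + k)%N -> 0 <= x -> 0 <= y -> 0 <= z ->
  z ^+ (n + k) <= x ^+ n * y ^+ k -> z <= (n%:R * x + k%:R * y) / (n + k)%:R.
Proof.
move=> nk_gt0 x_ge0 y_ge0 z_ge0 le_z.
have mean_ge0 : 0 <= (n%:R * x + k%:R * y) / (n + k)%:R.
  by rewrite divr_ge0 ?addr_ge0 ?mulr_ge0.
rewrite -(ler_pXn2r nk_gt0) ?nnegrE //; apply: le_trans le_z _.
pose E (i : 'I_n + 'I_k) := if i is inl _ then x else y.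
have [|AGM _] := @leif_AGM R _ predT E; first by case.
move: AGM; rewrite !big_sumType /= !prodr_const !sumr_const card_sum !card_ord.
by rewrite -[x *+ n]mulr_natl -[y *+ k]mulr_natl.
Qed.

Lemma le_add_of_expr_le_scale x y c n : 0 <= x -> 0 <= y <= 1 -> 0 <= c ->
  x ^+ n.+1 <= c * y ^+ n.+1 -> x <= y + c / n.+1%:R.
Proof.
move=> x_ge0 /andP[y_ge0 y_le1] c_ge0 le_x; have cy_ge0 := mulr_ge0 c_ge0 y_ge0.
have := @le_mean_of_expr_le y (c * y) x n 1; rewrite addn1 expr1 mulrCA -exprSr.
move=> /(_ isT y_ge0 cy_ge0 x_ge0 le_x)/le_trans; apply.
rewrite mul1r mulrDl; apply: lerD.
  by rewrite ler_pdivrMr ?ltr0n // mulrC ler_wpM2l // ler_nat.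
by rewrite ler_wpM2r ?invr_ge0 ?ler_piMr.
Qed.

End mean_inequality.

Lemma exists_div_natS_le (R : archiRealFieldType) (c e : R) n :
  0 < e -> exists2 m, (n < m)%N & c / m.+1%:R <= e.
Proof.
move=> e_gt0; exists (maxn n.+1 (Num.truncn (c / e))); first exact: leq_maxl.
rewrite ler_pdivrMr // mulrC -ler_pdivrMr //.
by apply/ltW/(lt_le_trans (truncnS_gt _)); rewrite ler_nat ltnS leq_maxr.
Qed.

Section real_powers.
Context {R : realType}.
Implicit Types (x : R) (n : nat).

Lemma fact_ge_expr n : (n%:R / expR 1) ^+ n <= n`!%:R :> R.
Proof.
case: n => [|n]; first by rewrite expr0 fact0.
have expR_ge := @expR_ge1Dxn R n.+1%:R n (ler0n _ _).
rewrite expr_div_n -expRM_natl mulr1 ler_pdivrMr ?expR_gt0 // mulrC.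
rewrite -ler_pdivrMr ?ltr0n ?fact_gt0 //; apply: le_trans expR_ge.
by rewrite lerDr.
Qed.

Lemma powR_invn_exprK x n : 0 <= x -> (x `^ n.+1%:R^-1) ^+ n.+1 = x.
Proof.
move=> x_ge0; rewrite -powR_mulrn ?powR_ge0 // -powRrM.
by rewrite mulVf ?powRr1 ?pnatr_eq0.
Qed.

End real_powers.

Section prefixes.
Context {T : Type}.
Implicit Types (w v : nat -> T) (n : nat).

Lemma eq_mkseqP w v n : mkseq w n = mkseq v n <-> {in gtn n, w =1 v}.
Proof.
split=> [eq_wv i lt_in|eq_wv].
  by have := congr1 (fun s => nth (w i) s i) eq_wv; rewrite !nth_mkseq.
by apply/eq_in_map => i; rewrite mem_iota; exact: eq_wv.
Qed.

Lemma eq_mkseq_leq w v m n : (m <= n)%N -> mkseq w n = mkseq v n ->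
  mkseq w m = mkseq v m.
Proof.
move=> le_mn /eq_mkseqP eq_wv; apply/eq_mkseqP => i; rewrite inE => lt_im.
by apply: eq_wv; rewrite inE (leq_trans lt_im).
Qed.

Definition splice w n v : nat -> T :=
  fun i => if (i < n)%N then w i else v (i - n)%N.

Lemma mkseq_splice w n v : mkseq (splice w n v) n = mkseq w n.
Proof. by apply/eq_mkseqP => i; rewrite inE /splice => ->. Qed.

Lemma splice_add w n v i : splice w n v (n + i) = v i.
Proof. by rewrite /splice ltnNge leq_addr /= addKn. Qed.

End prefixes.

Section continuations.
Context {T : Type} {R : realDomainType}.
Variables (a : (nat -> T) -> nat -> R) (err : nat -> R).
Variables (w : nat -> T) (n : nat).

Definition can_rise_to (hi : R) := exists w', [/\ mkseq w' n = mkseq w n,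
  forall m, (n <= m)%N -> Num.min (a w n) hi - err n <= a w' m &
  forall e, 0 < e -> exists2 m, (n < m)%N & hi - e <= a w' m].

Definition can_fall_to (lo : R) := exists w', [/\ mkseq w' n = mkseq w n,
  forall m, (n <= m)%N -> a w' m <= Num.max (a w n) lo + err n &
  forall e, 0 < e -> exists2 m, (n < m)%N & a w' m <= lo + e].

End continuations.

Lemma can_rise_to_opp (T : Type) (R : realDomainType)
    (a : (nat -> T) -> nat -> R) (err : nat -> R) w n (lo : R) :
  can_fall_to a err w n lo -> can_rise_to (fun v m => - a v m) err w n (- lo).
Proof.
move=> [w' [eq_w' aw'_le freq]]; exists w'; split=> //.
  by move=> m /aw'_le; rewrite -oppr_max; lra.
by move=> e /freq[m lt_nm aw'm_le]; exists m => //; lra.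
Qed.

Section Des_prob_variation.
Context {R : realType}.
Implicit Types (w : infword) (n k : nat).
Local Notation p w n := (Des_prob w n : R).

Lemma Des_prob_gt0 w n : 0 < p w n.
Proof. by rewrite divr_gt0 ?ltr0n ?d_gt0 ?fact_gt0. Qed.

Lemma Des_prob_ge0 w n : 0 <= p w n.
Proof. exact/ltW/Des_prob_gt0. Qed.

Lemma Des_prob_le1 w n : p w n <= 1.
Proof. by rewrite ler_pdivrMr ?mul1r ?ler_nat ?leq_d_fact ?ltr0n ?fact_gt0. Qed.

Lemma Des_prob_le_S w n : p w n <= n.+2%:R * p w n.+1.
Proof.
rewrite /Des_prob (factS n.+1) natrM invfM mulrCA [n.+2%:R * _]mulrA.
rewrite divff ?pnatr_eq0 // mul1r.
by rewrite ler_wpM2r ?invr_ge0 // ler_nat leq_d_dS.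
Qed.

Lemma Des_probS_le w n : p w n.+1 <= p w n.
Proof.
rewrite /Des_prob ler_pdivrMr ?ltr0n ?fact_gt0 // (factS n.+1) natrM mulrCA.
by rewrite divfK ?pnatr_eq0 -?lt0n ?fact_gt0 // -natrM ler_nat leq_dS_d.
Qed.

Lemma Des_prob_ascents w n k : (forall i, (i < k)%N -> w (n + i)%N = false) ->
  p w (n + k) <= p w n / k`!%:R.
Proof.
move=> /leq_d_ascents le_d.
have factR_gt0 m : 0 < m`!%:R :> R by rewrite ltr0n fact_gt0.
rewrite /Des_prob -mulrA -invfM ler_pdivrMr // mulrAC ler_pdivlMr ?mulr_gt0 //.
rewrite -!natrM ler_nat -(@bin_fact (n + k).+1 k) ?leqW ?leq_addl //.
by rewrite subSn ?leq_addl // addnK [(k`! * _)%N]mulnC [leqRHS]mulnA leq_mul.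
Qed.

Lemma eq_moment w w' n b :
  mkseq w n = mkseq w' n -> moment w n b = moment w' n b :> R.
Proof. by move=> eq_w; rewrite /moment /density /dlast /wprefix eq_w. Qed.

Lemma Des_prob_alternating w n : exists b, forall k,
  p w n * (2 / pi) ^+ k / 2 <= p (splice w n (fun i => b (+) odd i)) (n + k).
Proof.
have [b le_b] : exists b, p w n / 2 <= moment w n b.
  have [?|?] := leP (p w n / 2) (moment w n true); first by exists true.
  by exists false; have := @Des_prob_le_moments R w n; lra.
exists b => k; apply: le_trans (moment_le_Des_prob _ _ (b (+) odd k)).
rewrite alternating_moment => [|i _]; last exact: splice_add.
rewrite (eq_moment _ (mkseq_splice w n _)) mulrAC mulrC.
by rewrite ler_wpM2l ?exprn_ge0 ?divr_ge0 ?pi_ge0.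
Qed.

End Des_prob_variation.

Section root_variation.
Context {R : realType}.
Implicit Types (w : infword) (n m k : nat).
Local Notation p w n := (Des_prob w n : R).

Definition Des_root w n : R := dratio_root R w n.+1.

Local Notation a w n := (Des_root w n).

Lemma Des_root_ge0 w n : 0 <= a w n.
Proof. exact: powR_ge0. Qed.

Lemma Des_root_expr w n : a w n ^+ n.+1 = p w n.
Proof. exact/powR_invn_exprK/Des_prob_ge0. Qed.

Lemma Des_root_le1 w n : a w n <= 1.
Proof.
rewrite -(@ler_pXn2r _ n.+1) ?nnegrE ?Des_root_ge0 //.
by rewrite expr1n Des_root_expr Des_prob_le1.
Qed.

Lemma eq_Des_root w w' n : mkseq w n = mkseq w' n -> a w n = a w' n.
Proof. by move=> eq_w; rewrite /Des_root /dratio_root /d_ /wprefix eq_w. Qed.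

(* Dominates the errors met below: 2 / sqrt n for a single letter, 2 / n for an
   alternating run and expR 1 / n for a run of ascents. *)
Definition drift n : R := expR 1 * Num.sqrt (harmonic n).

Lemma expR1_ge2 : 2 <= expR 1 :> R.
Proof. by have := @expR_ge1Dx R 1; lra. Qed.

Lemma drift_gt0 n : 0 < drift n.
Proof. by rewrite mulr_gt0 ?expR_gt0 ?sqrtr_gt0 ?harmonic_gt0. Qed.

Lemma drift_le n m : (n <= m)%N -> drift m <= drift n.
Proof.
move=> le_nm; rewrite ler_wpM2l ?expR_ge0 // ler_sqrt ?harmonic_ge0 //.
by rewrite lef_pV2 ?posrE ?ltr0n // ler_nat.
Qed.

Lemma cvg_drift : (drift n @[n --> \oo] --> (0 : R))%classic.
Proof.
rewrite -(mulr0 (expR 1)) -(@sqrtr0 R); apply: cvgM; first exact: cvg_cst.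
by apply: continuous_cvg; [exact: sqrt_continuous|exact: cvg_harmonic].
Qed.

Lemma div_natS_le_drift n : expR 1 / n.+1%:R <= drift n.
Proof.
rewrite ler_wpM2l ?expR_ge0 // -[leLHS]sqr_sqrtr ?harmonic_ge0 //.
rewrite expr2 ler_piMr ?sqrtr_ge0 // -[leRHS]sqrtr1 ler_sqrt //.
by rewrite invf_le1 ?ler1n.
Qed.

Lemma Des_rootS_le w n : a w n.+1 <= a w n + drift n.+1.
Proof.
have := @le_mean_of_expr_le _ (a w n) 1 (a w n.+1) n.+1 1.
rewrite addn1 !Des_root_expr expr1n mulr1.
move=> /(_ isT (Des_root_ge0 _ _) ler01 (Des_root_ge0 _ _) (Des_probS_le _ _)).
move=> /le_trans; apply; rewrite mulrDl; apply: lerD.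
  by rewrite ler_pdivrMr // mulrC ler_wpM2l ?Des_root_ge0 // ler_nat.
apply: le_trans (div_natS_le_drift n.+1); rewrite ler_wpM2r ?invr_ge0 //.
by have := expR1_ge2; lra.
Qed.

Lemma Des_rootS_ge w n : a w n - drift n.+1 <= a w n.+1.
Proof.
set s : R := Num.sqrt n.+2%:R; set x := a w n.+1.
have s_gt0 : 0 < s by rewrite sqrtr_gt0.
have s_sqr : s ^+ 2 = n.+2%:R by rewrite sqr_sqrtr.
have [x_ge0 x_le1] : 0 <= x /\ x <= 1 by rewrite Des_root_ge0 Des_root_le1.
(* AM-GM is applied with the factor n + 2 shared between two terms. *)
have a_expr : a w n ^+ (n + 2) <= x ^+ n * (s * x) ^+ 2.
  rewrite exprMn s_sqr mulrCA -exprD addn2 Des_root_expr.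
  apply: le_trans (Des_prob_le_S w n); rewrite -Des_root_expr exprSr.
  by rewrite ler_piMr ?exprn_ge0 ?Des_root_ge0 ?Des_root_le1.
have sx_ge0 : 0 <= s * x by rewrite mulr_ge0 // ltW.
have := le_mean_of_expr_le _ x_ge0 sx_ge0 (Des_root_ge0 w n) a_expr.
rewrite addn2 -s_sqr => /(_ isT) le_a.
rewrite lerBlDr; apply: le_trans le_a _; rewrite mulrDl; apply: lerD.
  rewrite ler_pdivrMr ?exprn_gt0 // s_sqr mulrC ler_wpM2l // ler_nat.
  by rewrite !leqW.
rewrite /drift /= sqrtrV // -/s ler_pdivlMr // expr2 invfM !mulrA.
rewrite -[2 * s * x]mulrA [s * x]mulrC mulrA mulfK ?gt_eqF // divfK ?gt_eqF //.
by have := expR1_ge2; lra.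
Qed.

Lemma Des_root_step w n m : (n <= m)%N -> `|a w m.+1 - a w m| <= drift n.
Proof.
move=> le_nm; apply: le_trans (drift_le (leqW le_nm)).
by rewrite ler_distl Des_rootS_ge Des_rootS_le.
Qed.

Lemma Des_root_ascents w n k :
  a (splice w n (fun=> false)) (n + k) <=
  (n.+1%:R * a w n + expR 1) / (n + k).+1%:R.
Proof.
set w' := splice _ _ _.
have -> : a w n = a w' n by apply/eq_Des_root/esym/mkseq_splice.
pose y : R := expR 1 / k%:R.
have y_ge0 : 0 <= y by rewrite divr_ge0 ?expR_ge0.
have le_y : k%:R * y <= expR 1.
  have [->|k_gt0] := posnP k; first by rewrite mul0r expR_ge0.
  by rewrite mulrC divfK // pnatr_eq0 -lt0n.
have fact_le : (k`!%:R)^-1 <= y ^+ k.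
  have [->|k_gt0] := posnP k; first by rewrite expr0 fact0 invr1.
  rewrite -[y]invf_div exprVn lef_pV2 ?posrE ?ltr0n ?fact_gt0 ?fact_ge_expr //.
  by rewrite exprn_gt0 ?divr_gt0 ?ltr0n ?expR_gt0.
have asc_le : p w' (n + k) <= a w' n ^+ n.+1 * y ^+ k.
  rewrite Des_root_expr; apply: le_trans (_ : p w' n / k`!%:R <= _).
    by apply: Des_prob_ascents => i _; exact: splice_add.
  by rewrite ler_wpM2l ?Des_prob_ge0.
move: asc_le; rewrite -Des_root_expr -addSn.
move=> /le_mean_of_expr_le.
move=> /(_ isT (Des_root_ge0 _ _) y_ge0 (Des_root_ge0 _ _))/le_trans; apply.
by rewrite ler_wpM2r ?invr_ge0 // lerD2l.
Qed.

Lemma Des_root_fall w n : can_fall_to Des_root drift w n 0.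
Proof.
exists (splice w n (fun=> false)); split; first exact: mkseq_splice.
- move=> m /subnKC<-; apply: le_trans (Des_root_ascents _ _ _) _.
  rewrite (max_idPl _) ?Des_root_ge0 // mulrDl; apply: lerD.
    rewrite ler_pdivrMr // mulrC ler_wpM2l ?Des_root_ge0 // ler_nat.
    by rewrite ltnS leq_addr.
  apply: le_trans (div_natS_le_drift n); rewrite ler_wpM2l ?expR_ge0 //.
  by rewrite lef_pV2 ?posrE ?ltr0n // ler_nat ltnS leq_addr.
- move=> e /(exists_div_natS_le (n.+1%:R * a w n + expR 1) n)[m lt_nm le_e].
  exists m => //; rewrite add0r; apply: le_trans le_e.
  by rewrite -(subnKC (ltnW lt_nm)); exact: Des_root_ascents.
Qed.

Lemma Des_root_alternating w n : exists2 w', mkseq w' n = mkseq w n &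
  forall m, (n <= m)%N ->
    a w n ^+ n.+1 * (2 / pi) ^+ (m - n) <= 2 * a w' m ^+ m.+1.
Proof.
have [b p_ge] := @Des_prob_alternating R w n.
exists (splice w n (fun i => b (+) odd i)); first exact: mkseq_splice.
move=> m le_nm; rewrite !Des_root_expr [leRHS]mulrC -ler_pdivrMr //.
by have := p_ge (m - n)%N; rewrite subnKC.
Qed.

Lemma Des_root_rise w n : can_rise_to Des_root drift w n (2 / pi).
Proof.
have [w' eq_w' a_ge] := Des_root_alternating w n.
have rho_gt0 : 0 < 2 / pi :> R by rewrite divr_gt0 ?pi_gt0.
have a_gt0 : 0 < a w n by rewrite powR_gt0 // Des_prob_gt0.
move: (2 / pi : R) rho_gt0 a_ge => rho rho_gt0 a_ge.
have a'_itv m : 0 <= a w' m <= 1 by rewrite Des_root_ge0 Des_root_le1.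
exists w'; split=> // [m le_nm|e e_gt0].
- set c := Num.min _ _; have c_ge0 : 0 <= c by rewrite le_min !ltW.
  have [c_le_a c_le_rho] : c <= a w n /\ c <= rho by rewrite !ge_min !lexx orbT.
  rewrite lerBlDr; apply: le_trans (_ : a w' m + 2 / m.+1%:R <= _).
    apply: le_add_of_expr_le_scale => //; apply: le_trans (a_ge m le_nm).
    rewrite -{1}(subnKC le_nm) -addSn exprD.
    by apply: ler_pM; rewrite ?exprn_ge0 // lerXn2r ?nnegrE // ltW.
  rewrite lerD2l; apply: le_trans (div_natS_le_drift n).
  by apply: ler_pM; rewrite ?invr_ge0 ?expR1_ge2 // lef_pV2 ?posrE ?ler_nat.
- pose c := 2 * (rho / a w n) ^+ n.+1.
  have c_ge0 : 0 <= c by rewrite mulr_ge0 // exprn_ge0 // divr_ge0 // ltW.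
  have [m lt_nm le_e] := exists_div_natS_le c n e_gt0; exists m => //.
  rewrite lerBlDr; apply: le_trans (_ : a w' m + c / m.+1%:R <= _).
    apply: le_add_of_expr_le_scale => //; first exact: ltW rho_gt0.
    rewrite /c expr_div_n mulrA mulrAC ler_pdivlMr ?exprn_gt0 //.
    rewrite -{1}(subnKC (ltnW lt_nm)) -addSn exprD.
    have := ler_wpM2l (exprn_ge0 n.+1 (ltW rho_gt0)) (a_ge m (ltnW lt_nm)); lra.
  by rewrite lerD2l.
Qed.

End root_variation.

(** * Steering *)

Section upper_lower_limits.
Context {R : realType}.
Implicit Types (u : nat -> R) (l e : R).

Lemma limn_esupS (v : nat -> \bar R) :
  limn_esup (fun n => v n.+1) = limn_esup v.
Proof.
rewrite !limn_esup_lim.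
have -> : esups (fun n => v n.+1) = (fun n => esups v n.+1).
  apply/funext => n; congr ereal_sup; apply/seteqP; split=> _ [m /= le_nm <-].
    by exists m.+1.
  by case: m le_nm => // m le_nm; exists m.
apply: cvg_lim => //; rewrite (cvg_shiftS (esups v)).
exact: is_cvg_esups.
Qed.

Lemma limn_einfS (v : nat -> \bar R) :
  limn_einf (fun n => v n.+1) = limn_einf v.
Proof. by rewrite /limn_einf (limn_esupS (\- v)%E). Qed.

Lemma limn_esup_eq u l :
  (forall e, 0 < e -> (\forall n \near \oo, u n <= l + e)%classic) ->
  (forall e, 0 < e -> forall N, exists2 n, (N <= n)%N & l - e <= u n) ->
  limn_esup (fun n => (u n)%:E) = l%:E.
Proof.
move=> ub lb; apply/eqP; rewrite eq_le; apply/andP; split.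
  apply/lee_addgt0Pr => e /ub near_ub; apply: ge_ereal_inf.
  exists (ereal_sup ((fun n => (u n)%:E) @` [set n | u n <= l + e]%classic)).
    by exists [set n | u n <= l + e]%classic.
  by apply: ge_ereal_sup => _ [n /= le_u <-]; rewrite -EFinD lee_fin.
apply: le_ereal_inf_tmp => _ [A [N _ NA] <-].
apply/lee_subgt0Pr => e /lb/(_ N)[n le_Nn le_u].
apply: le_ereal_sup_tmp; exists (u n)%:E; last by rewrite -EFinB lee_fin.
by exists n => //; exact: NA.
Qed.

Lemma limn_einf_eq u l :
  (forall e, 0 < e -> (\forall n \near \oo, l - e <= u n)%classic) ->
  (forall e, 0 < e -> forall N, exists2 n, (N <= n)%N & u n <= l + e) ->
  limn_einf (fun n => (u n)%:E) = l%:E.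
Proof.
move=> lb ub; rewrite /limn_einf.
rewrite (@limn_esup_eq (fun n => - u n) (- l)) ?EFinN ?oppeK //.
  by move=> e /lb; apply: filterS => n; lra.
by move=> e /ub freq N; have [n le_Nn le_u] := freq N; exists n => //; lra.
Qed.

End upper_lower_limits.

Lemma first_passage (R : realDomainType) (u : nat -> R) (t d : R) n :
  0 <= d -> u n <= t -> (forall m, (n <= m)%N -> u m.+1 <= u m + d) ->
  (exists2 m, (n < m)%N & t - d <= u m) ->
  exists m, [/\ (n < m)%N, `|u m - t| <= d &
                forall j, (n <= j <= m)%N -> u j <= t + d].
Proof.
move=> d_ge0 un_le step [m0 lt_nm0 le_um0].
have ex_m : exists m, (n < m)%N && (t - d <= u m) by exists m0; rewrite lt_nm0.
case: (ex_minnP ex_m) => m /andP[lt_nm um_ge] m_min.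
have before j : (n <= j < m)%N -> u j <= t.
  rewrite leq_eqVlt => /andP[/predU1P[<- //|lt_nj] lt_jm].
  have [le_uj|/ltW lt_uj] := leP (t - d) (u j); last by lra.
  by have := m_min j; rewrite lt_nj le_uj leqNgt lt_jm => /(_ isT).
have um_le : u m <= t + d.
  case: m lt_nm before {um_ge m_min} => // m; rewrite ltnS => le_nm before.
  have um_le : u m <= t by apply: before; rewrite le_nm ltnSn.
  by have := step m le_nm; lra.
exists m; split=> // [|j]; first by rewrite ler_distl um_ge um_le.
rewrite [(j <= m)%N]leq_eqVlt andb_orr => /orP[/andP[_ /eqP->] //|/before].
by lra.
Qed.

Section increasing_indices.
Variable N : nat -> nat.
Hypothesis N_ltS : forall k, (N k < N k.+1)%N.
Local Open Scope nat_scope.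

Lemma increasing_ge_id k : k <= N k.
Proof. by elim: k => // k IHk; exact: leq_ltn_trans (N_ltS k). Qed.

Lemma increasing_leq k l : k <= l -> N k <= N l.
Proof. exact: (homo_leq leqnn leq_trans (fun k => ltnW (N_ltS k))). Qed.

Lemma increasing_bracket K j :
  N K <= j -> exists2 k, K <= k & N k <= j <= N k.+1.
Proof.
move=> le_NK; have bounded k : N k <= j -> k <= j.
  exact: leq_trans (increasing_ge_id k).
have [k le_Nk k_max] := ex_maxnP (ex_intro _ K le_NK) bounded.
exists k; first exact: k_max.
by rewrite le_Nk ltnW // ltnNge; apply/negP => /k_max; rewrite ltnn.
Qed.

Lemma exists_limit_word (T : Type) (W : nat -> nat -> T) :
  (forall k, mkseq (W k.+1) (N k) = mkseq (W k) (N k)) ->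
  exists w, forall k, mkseq w (N k) = mkseq (W k) (N k).
Proof.
move=> extS; have ext k l : k <= l -> mkseq (W l) (N k) = mkseq (W k) (N k).
  elim: l => [|l IHl]; first by case: k.
  rewrite leq_eqVlt ltnS => /predU1P[-> //|le_kl]; rewrite -IHl //.
  exact: eq_mkseq_leq (increasing_leq le_kl) (extS l).
exists (fun i => W i.+1 i) => k; apply/eq_mkseqP => i; rewrite inE => lt_i.
have [le_ki|/ltnW le_ik] := leqP k i.+1.
  by have /eq_mkseqP := ext _ _ le_ki; apply; rewrite inE.
by have /eq_mkseqP := ext _ _ le_ik => ->; rewrite // inE increasing_ge_id.
Qed.

End increasing_indices.

Section steered.
Context {T : Type} {R : realType}.
Variables (a : (nat -> T) -> nat -> R) (err : nat -> R).
Implicit Types (w : nat -> T) (n m : nat) (s hi : R).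

Definition steered w n m s :=
  `|a w m - s| <= err n /\ forall j, (n <= j <= m)%N ->
    Num.min (a w n) s - err n <= a w j <= Num.max (a w n) s + err n.

Hypothesis eq_a : forall w w' n, mkseq w n = mkseq w' n -> a w n = a w' n.

Lemma eq_steered w w' n m s : (n <= m)%N -> mkseq w m = mkseq w' m ->
  steered w n m s -> steered w' n m s.
Proof.
move=> le_nm eq_w; have eq_aw j : (j <= m)%N -> a w j = a w' j.
  by move=> le_jm; apply: eq_a; exact: eq_mkseq_leq le_jm eq_w.
move=> [near_s bounds]; split=> [|j /[dup] /andP[_ le_jm] /bounds].
  by rewrite -eq_aw.
by rewrite !eq_aw.
Qed.

Lemma steer_up w n s hi : 0 < err n ->
  (forall w' m, (n <= m)%N -> `|a w' m.+1 - a w' m| <= err n) ->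
  can_rise_to a err w n hi -> a w n <= s <= hi ->
  exists w' m, [/\ (n < m)%N, mkseq w' n = mkseq w n & steered w' n m s].
Proof.
move=> err_gt0 step [w' [eq_w' aw'_ge freq]] /andP[aw_le s_le].
rewrite -(eq_a eq_w') in aw_le aw'_ge.
have [||m le_nm||m [lt_nm near_s aw'_le]] :=
  @first_passage _ (a w') s (err n) n.
- exact: ltW.
- by [].
- by have := step w' m le_nm; rewrite ler_distl => /andP[].
- have [m lt_nm le_aw'] := freq _ err_gt0; exists m => //.
  by apply: le_trans le_aw'; rewrite lerD2r.
exists w', m; split=> //; split=> // j /[dup] /andP[le_nj _] /aw'_le aw'j_le.
rewrite (min_idPl aw_le) (max_idPr aw_le) aw'j_le andbT.
by have := aw'_ge j le_nj; rewrite (min_idPl (le_trans aw_le s_le)).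
Qed.

End steered.

Section steering.
Context {T : Type} {R : realType}.
Variables (a : (nat -> T) -> nat -> R) (err : nat -> R) (lo hi : R).
Implicit Types (w : nat -> T) (n m k : nat) (s e : R).

Hypothesis eq_a : forall w w' n, mkseq w n = mkseq w' n -> a w n = a w' n.
Hypothesis err_gt0 : forall n, 0 < err n.
Hypothesis cvg_err : (err n @[n --> \oo] --> (0 : R))%classic.
Hypothesis a_step : forall w n m, (n <= m)%N -> `|a w m.+1 - a w m| <= err n.
Hypothesis a_rise : forall w n, can_rise_to a err w n hi.
Hypothesis a_fall : forall w n, can_fall_to a err w n lo.
Local Notation steered := (steered a err).

Lemma steer_down w n s : lo <= s <= a w n ->
  exists w' m, [/\ (n < m)%N, mkseq w' n = mkseq w n & steered w' n m s].
Proof.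
move=> s_itv; pose Na v m := - a v m.
have [v v' m /eq_a eq_v|v m le_nm|||w' [m [lt_nm eq_w' [near_s bounds]]]] :=
  @steer_up T R Na err _ w n (- s) (- lo) (err_gt0 n).
- by rewrite /Na eq_v.
- by rewrite /Na -opprD normrN a_step.
- exact: can_rise_to_opp.
- by rewrite /Na !lerN2 andbC.
exists w', m; split=> //; split=> [|j /bounds].
  by move: near_s; rewrite /Na -opprD normrN.
by rewrite /Na -oppr_max -oppr_min; lra.
Qed.

Lemma steer_to w n s : lo <= s <= hi ->
  exists w' m, [/\ (n < m)%N, mkseq w' n = mkseq w n & steered w' n m s].
Proof.
move=> /andP[s_ge s_le]; have [le_aw|/ltW le_aw] := leP (a w n) s.
  apply: (@steer_up _ _ _ _ eq_a _ _ _ hi) => //; last by rewrite le_aw.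
  by move=> w'; exact: a_step.
by apply: steer_down; rewrite s_ge.
Qed.

Lemma exists_steered_word (w0 : nat -> T) (t : nat -> R) :
  (forall k, lo <= t k <= hi) -> exists w (N : nat -> nat),
    (forall k, (N k < N k.+1)%N) /\ forall k, steered w (N k) (N k.+1) (t k).
Proof.
move=> t_itv.
pose next (x y : nat * (nat -> T) * nat) := [/\ y.1.1 = x.1.1.+1, (x.2 < y.2)%N,
  mkseq y.1.2 x.2 = mkseq x.1.2 x.2 & steered y.1.2 x.2 y.2 (t x.1.1)].
have next_ex x : {y | next x y}.
  apply: cid; case: x => [[k w] n].
  have [w' [m [lt_nm eq_w' st]]] := steer_to w n (t_itv k).
  by exists (k.+1, w', m).
have [x [x0 x_next]] := dependent_choice next_ex (0%N, w0, 0%N).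
have x_step k : (x k).1.1 = k.
  elim: k => [|k IHk]; first by rewrite x0.
  by have [-> _ _ _] := x_next k; rewrite IHk.
pose N k := (x k).2; have N_ltS k : (N k < N k.+1)%N by have [] := x_next k.
have [|w w_prefix] := @exists_limit_word N N_ltS T (fun k => (x k).1.2).
  by move=> k; have [] := x_next k.
exists w, N; split=> // k; have [_ _ _] := x_next k; rewrite x_step.
exact: eq_steered (ltnW (N_ltS k)) (esym (w_prefix k.+1)).
Qed.

Section steered_word.
Variables (w : nat -> T) (N : nat -> nat) (t : nat -> R) (l l' : R).
Hypothesis N_ltS : forall k, (N k < N k.+1)%N.
Hypothesis w_steered : forall k, steered w (N k) (N k.+1) (t k).
Hypothesis t_itv : forall k, l <= t k <= l'.

Lemma near_err_le e : 0 < e -> (\forall k \near \oo, err (N k) <= e)%classic.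
Proof.
move=> e_gt0; have /cvgrPdist_le/(_ e e_gt0)[K _ err_le] := cvg_err.
exists K => // k le_Kk.
have := err_le (N k) (leq_trans le_Kk (increasing_ge_id N_ltS k)).
by rewrite sub0r normrN gtr0_norm.
Qed.

Lemma near_steered_target e : 0 < e ->
  (\forall k \near \oo, t k - e <= a w (N k.+1) <= t k + e)%classic.
Proof.
move=> /near_err_le; apply: filterS => k err_le.
by rewrite -ler_distl; apply: le_trans err_le; case: (w_steered k).
Qed.

Lemma near_steered_itv e : 0 < e ->
  (\forall j \near \oo, l - e <= a w j <= l' + e)%classic.
Proof.
move=> e_gt0; have e2_gt0 : 0 < e / 2 by rewrite divr_gt0.
have [K _ near_t] := near_steered_target e2_gt0.
have [M _ err_le] := near_err_le e2_gt0.
exists (N (maxn K M).+1) => // j /(increasing_bracket N_ltS)[[//|k] le_k j_itv].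
rewrite ltnS geq_max in le_k; case/andP: le_k => le_Kk le_Mk.
have [_ /(_ j j_itv)] := w_steered k.+1; set x := a w (N k.+1).
have /andP[l_le_t t_le_l'] := t_itv k.
have /andP[l_le_tS tS_le_l'] := t_itv k.+1.
have /andP[x_ge x_le] : t k - e / 2 <= x <= t k + e / 2 := near_t k le_Kk.
have err_small : err (N k.+1) <= e / 2 := err_le k.+1 (leqW le_Mk).
have min_ge : l - e / 2 <= Num.min x (t k.+1) by rewrite le_min; lra.
have max_le : Num.max x (t k.+1) <= l' + e / 2 by rewrite ge_max; lra.
by lra.
Qed.

End steered_word.

Lemma exists_oscillating_word (w0 : nat -> T) (l l' : R) :
  lo <= l -> l <= l' -> l' <= hi -> exists w,
    limn_einf (fun n => (a w n)%:E) = l%:E /\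
    limn_esup (fun n => (a w n)%:E) = l'%:E.
Proof.
move=> l_ge le_ll' l'_le; pose t k := if odd k then l else l'.
have t_itv k : l <= t k <= l' by rewrite /t; case: odd; rewrite lexx le_ll'.
have [|w [N [N_ltS w_steered]]] := @exists_steered_word w0 t.
  move=> k; have /andP[t_ge t_le] := t_itv k.
  by rewrite (le_trans l_ge) // (le_trans t_le).
have near_itv := near_steered_itv N_ltS w_steered t_itv.
have freq b e M : 0 < e -> exists2 n, (M <= n)%N &
    (if b then l else l') - e <= a w n <= (if b then l else l') + e.
  move=> /(near_steered_target N_ltS w_steered)[K _ near_t].
  pose k := (b + (maxn K M).*2)%N; exists (N k.+1).
    by have := increasing_ge_id N_ltS k.+1; rewrite /k; lia.
  have := near_t k; rewrite /t /k oddD odd_double addbF oddb.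
  by apply; rewrite /=; lia.
exists w; split.
- apply: limn_einf_eq => e e_gt0.
    by apply: filterS (near_itv e e_gt0) => n /andP[].
  by move=> M; have [n le_Mn /andP[]] := freq true e M e_gt0; exists n.
- apply: limn_esup_eq => e e_gt0.
    by apply: filterS (near_itv e e_gt0) => n /andP[].
  by move=> M; have [n le_Mn /andP[]] := freq false e M e_gt0; exists n.
Qed.

End steering.

Theorem theorem3p13 (R : realType) (L L' : R)
    (hL : L \in `[0, 2 / pi]) (hL' : L' \in `[0, 2 / pi]) (hLL' : L <= L') :
  exists w : infword,
    limn_einf (fun n : nat => (dratio_root R w n)%:E) = L%:E /\
    limn_esup (fun n : nat => (dratio_root R w n)%:E) = L'%:E.
Proof.
have [/andP[L_ge0 _] /andP[_ L'_le]] : 0 <= L <= 2 / pi /\ 0 <= L' <= 2 / pi.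
  by move: hL hL'; rewrite !in_itv.
have [w [inf_w sup_w]] := exists_oscillating_word
  (@eq_Des_root R) (@drift_gt0 R) (@cvg_drift R) (@Des_root_step R)
  (@Des_root_rise R) (@Des_root_fall R) (fun=> false) L_ge0 hLL' L'_le.
by exists w; rewrite -limn_einfS -limn_esupS.
Qed.
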